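(* Suppose $u_1, u_2\in \mathcal{D}^{1,p}(\mathbb{R}^n)$ are nonconstant extremals whose $1-n/p$ Hölder seminorms are both maximized at a pair of distinct points $x_0,y_0\in\mathbb{R}^n$, i.e. $[u_i]_{C^{1-n/p}(\mathbb{R}^n)}=\frac{|u_i(x_0)-u_i(y_0)|}{|x_0-y_0|^{1-n/p}}$ for $i=1,2$. If in addition $$u_1(x_0)=u_2(x_0)\quad \text{and}\quad u_1(y_0)=u_2(y_0),$$ then $u_1(x)=u_2(x)$ for all $x\in \mathbb{R}^n$.
   Context: Throughout, $n\ge 1$ is an integer and $n<p<\infty$. $\mathcal{D}^{1,p}(\mathbb{R}^n)$ is the space of $u\in L^1_{\mathrm{loc}}(\mathbb{R}^n)$ whose weak first-order partial derivatives all belong to $L^p(\mathbb{R}^n)$. Every such $u$ has a Hölder continuous representative and is always identified with it. Put $[u]_{C^{1-n/p}(\mathbb{R}^n)}:=\sup_{x\ne y}\frac{|u(x)-u(y)|}{|x-y|^{1-n/p}}$ and $\|Du\|_{L^p(\mathbb{R}^n)}:=\left(\int_{\mathbb{R}^n}|Du|^p\,dx\right)^{1/p}$. Morrey's inequality says there is a finite constant $C$ with $[u]_{C^{1-n/p}(\mathbb{R}^n)}\le C\|Du\|_{L^p(\mathbb{R}^n)}$ for all $u\in\mathcal{D}^{1,p}(\mathbb{R}^n)$; $C_*$ denotes the sharp (smallest) such constant. An extremal is a function $u\in\mathcal{D}^{1,p}(\mathbb{R}^n)$ with $[u]_{C^{1-n/p}(\mathbb{R}^n)}=C_*\|Du\|_{L^p(\mathbb{R}^n)}$.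 *)

(* Defs.v *)
From HB Require Import structures.
From mathcomp Require Import all_boot all_order all_algebra.
From mathcomp Require Import all_classical all_reals all_analysis.
Set Implicit Arguments.
Unset Strict Implicit.
Unset Printing Implicit Defensive.
Import Order.TTheory GRing.Theory Num.Theory.
Import numFieldNormedType.Exports.
Local Open Scope classical_set_scope.
Local Open Scope ring_scope.

(* 'rV[R]_n carries the product sigma-algebra of the coordinates, i.e. the
   Borel sigma-algebra of R^n. *)
Definition rV_display : measure_display -> measure_display.
Proof. exact. Qed.

Section measurable_rV.
Variables (R : realType) (n : nat).

Let coord (i : 'I_n) (x : 'rV[R]_n) : measurableTypeR R := x 0 i.

Let rV_set0 : g_sigma_preimage coord set0.
Proof. exact: sigma_algebra0. Qed.

Let rV_setC A : g_sigma_preimage coord A -> g_sigma_preimage coord (~` A).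
Proof. exact: sigma_algebraC. Qed.

Let rV_bigcup (F : _^nat) : (forall i, g_sigma_preimage coord (F i)) ->
  g_sigma_preimage coord (\bigcup_i (F i)).
Proof. exact: sigma_algebra_bigcup. Qed.

HB.instance Definition _ :=
  @isMeasurable.Build (rV_display default_measure_display) 'rV[R]_n (g_sigma_preimage coord) rV_set0 rV_setC rV_bigcup.

Lemma measurable_coord i : measurable_fun [set: 'rV[R]_n] (fun x => x 0 i : R).
Proof.
move=> _ Y mY; rewrite setTI; apply: sub_sigma_algebra => /=.
rewrite -bigcup_seq/=; exists i => /=; first by rewrite mem_index_enum.
by exists Y => //; rewrite setTI.
Qed.

Lemma measurable_fun_rVP d (T : measurableType d) (f : T -> 'rV[R]_n) :
  measurable_fun setT f <-> forall i, measurable_fun setT (fun t => f t 0 i : R).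
Proof.
split=> [mf i|mf].
  exact: (measurableT_comp (measurable_coord i) mf).
move=> _ A mA; rewrite setTI.
have : preimage_set_system setT f measurable `<=` measurable.
  rewrite -[X in preimage_set_system _ _ X]/(g_sigma_preimage coord).
  rewrite -g_sigma_preimage_comp.
  apply: smallest_sub; first exact: sigma_algebra_measurable.
  rewrite -bigcup_seq/=; apply: bigcup_sub => i _ B [C mC <-].
  exact: mf.
by apply; exists A => //; rewrite setTI.
Qed.
End measurable_rV.

Section lebesgue_rV.
Variable R : realType.

Definition rVcons n (z : measurableTypeR R * 'rV[R]_n) : 'rV[R]_n.+1 :=
  \row_i oapp (fun j => z.2 0 j) z.1 (unlift ord0 i).

Lemma rVcons_0 n (z : measurableTypeR R * 'rV[R]_n) : rVcons z 0 0 = z.1.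
Proof. by rewrite mxE unlift_none. Qed.

Lemma rVcons_lift n (z : measurableTypeR R * 'rV[R]_n) (j : 'I_n) :
  rVcons z 0 (lift ord0 j) = z.2 0 j.
Proof. by rewrite mxE liftK. Qed.

Lemma measurable_rVcons n : measurable_fun setT (@rVcons n).
Proof.
apply/measurable_fun_rVP => i.
case: (unliftP ord0 i) => [j ->|->].
  under eq_fun do rewrite rVcons_lift.
  exact: (measurableT_comp (@measurable_coord R n j) measurable_snd).
under eq_fun do rewrite rVcons_0.
exact: measurable_fst.
Qed.

Definition cons_measure n
    (mu : {sigma_finite_measure set 'rV[R]_n -> \bar R}) :=
  pushforward (lebesgue_measure \x mu)%E (@rVcons n).

Section cons_measure.
Variables (n : nat) (mu : {sigma_finite_measure set 'rV[R]_n -> \bar R}).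

Let cons_measure0 : cons_measure mu set0 = 0%E.
Proof. by rewrite /cons_measure /pushforward preimage_set0 measure0. Qed.

Let cons_measure_ge0 A : (0 <= cons_measure mu A)%E.
Proof. by rewrite /cons_measure /pushforward measure_ge0. Qed.

Let cons_measure_sigma_additive : semi_sigma_additive (cons_measure mu).
Proof.
by apply: measure_semi_sigma_additive; exact: measurable_rVcons.
Qed.

HB.instance Definition _ := isMeasure.Build _ _ _ (cons_measure mu)
  cons_measure0 cons_measure_ge0 cons_measure_sigma_additive.

Let cons_measure_sigma_finite : sigma_finite setT (cons_measure mu).
Proof.
have /sigma_finiteP[F [TF ndF Foo]] := sigma_finiteT (@lebesgue_measure R).
have /sigma_finiteP[G [TG ndG Goo]] := sigma_finiteT mu.
pose tail (x : 'rV[R]_n.+1) : 'rV[R]_n := \row_j x 0 (lift ord0 j).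
have mtail : measurable_fun setT tail.
  apply/measurable_fun_rVP => j.
  by under eq_fun do rewrite mxE; exact: measurable_coord.
exists (fun k => (fun x : 'rV[R]_n.+1 => x 0 0) @^-1` F k `&` tail @^-1` G k).
  apply/esym; rewrite -subTset => x _.
  have [i _ Fi] : (\bigcup_i F i) (x 0 0) by rewrite -TF.
  have [j _ Gj] : (\bigcup_i G i) (tail x) by rewrite -TG.
  exists (maxn i j) => //; split.
    by have /ndF/subsetPset := leq_maxl i j; exact.
  by have /ndG/subsetPset := leq_maxr i j; exact.
move=> k; have [mF Fk] := Foo k; have [mG Gk] := Goo k; split.
  apply: measurableI; rewrite -[X in measurable X]setTI.
    exact: (@measurable_coord R n.+1 0).
  exact: mtail.
rewrite /cons_measure /pushforward (_ : _ @^-1` _ = F k `*` G k).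
  by rewrite product_measure1E// lte_mul_pinfty// ge0_fin_numE.
apply/seteqP; split=> -[t y] /=; rewrite rVcons_0.
  all: rewrite (_ : tail _ = y) //.
  all: by apply/rowP => j; rewrite mxE rVcons_lift.
Qed.

HB.instance Definition _ := Measure_isSigmaFinite.Build _ _ _ (cons_measure mu)
  cons_measure_sigma_finite.
End cons_measure.

(* n-dimensional Lebesgue measure, via R^(n+1) = R * R^n; lebesgue_rV_box below
   gives its value on boxes, which determines it. *)
Fixpoint lebesgue_rV n : {sigma_finite_measure set 'rV[R]_n -> \bar R} :=
  if n is m.+1 then cons_measure (lebesgue_rV m) else \d_(0 : 'rV[R]_0).

Lemma measurable_box n (A : 'I_n -> set (measurableTypeR R)) :
  (forall i, measurable (A i)) ->
  measurable [set x : 'rV[R]_n | forall i, A i (x 0 i)].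
Proof.
move=> mA; rewrite (_ : mkset _ =
    \bigcap_(i in [set: 'I_n]) ((fun x : 'rV[R]_n => x 0 i) @^-1` A i)).
  apply: fin_bigcap_measurable => // i _; rewrite -[X in measurable X]setTI.
  by apply: (@measurable_coord R n i) => //; exact: mA.
by apply/seteqP; split=> x /= Ax i; [move=> _; exact: Ax|exact: Ax].
Qed.

Lemma lebesgue_rV_box n (A : 'I_n -> set (measurableTypeR R)) :
  (forall i, measurable (A i)) ->
  lebesgue_rV n [set x | forall i, A i (x 0 i)] =
  (\prod_(i < n) lebesgue_measure (A i))%E.
Proof.
elim: n A => [|n ih] A mA.
  by rewrite big_ord0 /= diracE mem_set// => -[].
rewrite big_ord_recl -(ih (fun j => A (lift ord0 j)))//.
rewrite -product_measure1E//; last first.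
  exact: (@measurable_box n (fun j => A (lift ord0 j)) (fun j => mA _)).
rewrite [LHS]/= /cons_measure /pushforward.
congr (product_measure1 _ _ _); apply/seteqP; split=> [[t y] /= Ax|].
  split; first by have := Ax 0; rewrite rVcons_0.
  by move=> j; have := Ax (lift ord0 j); rewrite rVcons_lift.
move=> [t y] [/= At Ay] i.
by case: (unliftP ord0 i) => [j ->|->]; rewrite ?rVcons_lift ?rVcons_0.
Qed.
End lebesgue_rV.

Section morrey.
Variables (R : realType) (n : nat).
Implicit Types (u phi : 'rV[R]_n -> R) (g : 'rV[R]_n -> 'rV[R]_n) (p : R).

Local Notation mu := (@lebesgue_rV R n).

(* The library norm on 'rV[R]_n is the sup norm; it induces the same topology
   as the Euclidean norm but must not be used for distances here. *)
Definition enorm (x : 'rV[R]_n) : R := Num.sqrt (\sum_(i < n) x 0 i ^+ 2).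

Definition loc_integrable u :=
  measurable_fun [set: 'rV[R]_n] u /\
  forall K : set 'rV[R]_n, compact K -> mu.-integrable K (EFin \o u).

(* C^k: all partial derivatives exist and are C^(k-1). *)
Fixpoint Ck (k : nat) phi : Prop :=
  if k is k'.+1 then
    continuous phi /\
    forall i : 'I_n, (forall x, derivable phi x (delta_mx 0 i)) /\
                     Ck k' (fun x => 'D_(delta_mx 0 i) phi x)
  else continuous phi.

Definition test_function phi :=
  (forall k, Ck k phi) /\ compact (closure [set x | phi x != 0]).

Definition weak_partial (i : 'I_n) u (v : 'rV[R]_n -> R) :=
  [/\ loc_integrable u, loc_integrable v &
    forall phi, test_function phi ->
      (\int[mu]_x (u x * 'D_(delta_mx 0 i) phi x)%:E =
       - \int[mu]_x (v x * phi x)%:E)%E].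

(* A weak gradient is only determined up to a null set, so "g represents Du" is
   a relation, and ||Du||_p is [grad_norm p g] for any such g, which does not
   depend on the choice of g. *)
Definition weak_gradient u g :=
  forall i : 'I_n, weak_partial i u (fun x => g x 0 i).

(* Elements of the space are identified with their continuous representative,
   so they are plain continuous functions. *)
Definition D1p p u :=
  [/\ continuous u, loc_integrable u &
    exists2 g, weak_gradient u g &
      forall i : 'I_n, (fun x => g x 0 i) \in Lfun mu p%:E].

Definition grad_norm p g : \bar R := Lnorm mu p%:E (EFin \o enorm \o g).

Definition holder_quotient p u (x y : 'rV[R]_n) : R :=
  `|u x - u y| / enorm (x - y) `^ (1 - n%:R / p).

Definition holder_seminorm p u : \bar R :=
  ereal_sup [set (holder_quotient p u z.1 z.2)%:E
            | z in [set z : 'rV[R]_n * 'rV[R]_n | z.1 <> z.2]].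

Definition morrey_bound p (C : R) :=
  forall u g, D1p p u -> weak_gradient u g ->
    (holder_seminorm p u <= C%:E * grad_norm p g)%E.

(* The infimum is taken in the extended reals, so that no junk value could
   arise if there were no admissible constant. *)
Definition morrey_const p : \bar R :=
  ereal_inf [set C%:E | C in [set C : R | morrey_bound p C]].

Definition extremal p u :=
  D1p p u /\
  exists2 g, weak_gradient u g &
    holder_seminorm p u = (morrey_const p * grad_norm p g)%E.

End morrey.

(* Main.v *)
(* If u1 and u2 are extremals with the same values at x0 and y0, then
   |Du1|_p = |Du2|_p = N, and their average u has Hoelder seminorm at least the
   common quotient C_* N at (x0, y0), so that |Du|_p >= N.  Strict convexity of
   |.|^p then forces Du1 = Du2 almost everywhere.  Hence u1 - u2 has a zero weak
   gradient, and any admissible constant in Morrey's inequality makes it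
   constant; it vanishes at x0.  Morrey's inequality itself needs no proof: the
   finite nonzero seminorm of a nonconstant extremal rules out C_* = +oo. *)
Require Import Defs.
From mathcomp Require Import all_boot all_order all_algebra.
From mathcomp Require Import all_classical all_reals all_analysis.
From mathcomp Require Import measurable_realfun ring lra.
Import Order.TTheory GRing.Theory Num.Theory.
Import numFieldNormedType.Exports.
Local Open Scope classical_set_scope.
Local Open Scope ring_scope.

(** * Strict convexity of real powers on the half-line *)

(** Strict Bernoulli inequality for a real exponent, with the tangent taken at 1; homogeneity will
    move any other point of tangency there. *)
Lemma powR_tangent_lt {R : realType} (p x : R) :
  1 < p -> 0 <= x -> x != 1 -> 1 + p * (x - 1) < x `^ p.
Proof.
move=> p1; rewrite le_eqVlt => /predU1P[<- _|x0 xN1].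
  by rewrite powR0; lra.
have lnx0 : ln x != 0.
  by apply: contra xN1 => /eqP lnx; rewrite -(lnK x0) lnx expR0.
(* x ^ p = x * exp ((p - 1) * ln x), so apply 1 + y < exp y twice. *)
have e1 : 1 + (p - 1) * ln x < expR ((p - 1) * ln x).
  by apply: expR_gt1Dx; rewrite mulf_neq0// subr_eq0 gt_eqF.
have e2 : 1 - ln x < x^-1.
  rewrite -[x in x^-1](lnK x0) -expRN; apply: expR_gt1Dx.
  by rewrite oppr_eq0.
have -> : x `^ p = x * expR ((p - 1) * ln x).
  rewrite /powR gt_eqF// -[X in X * expR _](lnK x0) -expRD.
  by congr expR; ring.
have p10 : 0 < p - 1 by lra.
(* The weight [p - 1] on [e2] cancels the logarithms: the left side is [p * x], the right side
   [x ^ p + (p - 1)]. *)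
have : x * (1 + (p - 1) * ln x + (p - 1) * (1 - ln x)) <
       x * (expR ((p - 1) * ln x) + (p - 1) * x^-1).
  by rewrite ltr_pM2l// ltrD// ltr_pM2l.
rewrite [X in _ < X]mulrDr [x * (_ * x^-1)]mulrCA divff ?gt_eqF// mulr1.
by lra.
Qed.

(** After division by the midpoint [m], the tangent inequality at 1 applies to [s / m] and [t / m];
    since these add up to 2, the first-order terms cancel in the sum. *)
Lemma powR_midpoint_lt {R : realType} (p s t : R) :
  1 < p -> 0 <= s -> 0 <= t -> s != t ->
  (2^-1 * (s + t)) `^ p < 2^-1 * (s `^ p + t `^ p).
Proof.
move=> p1 s0 t0 st; pose m := 2^-1 * (s + t).
have m0 : 0 < m.
  have : 0 <= m by rewrite /m; lra.
  rewrite le_eqVlt => /predU1P[m0|//]; move: st; rewrite (_ : s = t) ?eqxx//.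
  by move: m0; rewrite /m; lra.
have mn : m != 0 by rewrite gt_eqF.
have sm1 : s / m != 1.
  apply: contra st => /eqP e; have : s = m by rewrite -[s](divfK mn) e mul1r.
  by rewrite /m => h; apply/eqP; lra.
have tm1 : t / m != 1.
  apply: contra st => /eqP e; have : t = m by rewrite -[t](divfK mn) e mul1r.
  by rewrite /m => h; apply/eqP; lra.
have sm0 : 0 <= s / m by rewrite divr_ge0// ltW.
have tm0 : 0 <= t / m by rewrite divr_ge0// ltW.
have hs := powR_tangent_lt p _ p1 sm0 sm1.
have ht := powR_tangent_lt p _ p1 tm0 tm1.
have stm : s / m + t / m = 2.
  by rewrite -mulrDl; apply: (mulIf mn); rewrite divfK// /m; field.
have -> : s `^ p = (s / m) `^ p * m `^ p by rewrite -powRM ?divfK// ltW.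
have -> : t `^ p = (t / m) `^ p * m `^ p by rewrite -powRM ?divfK// ltW.
rewrite -/m -mulrDl mulrA -[ltLHS]mul1r ltr_pM2r ?powR_gt0//.
have pE : p * (s / m - 1) + p * (t / m - 1) = 0.
  by rewrite -mulrDr addrACA stm; ring.
by lra.
Qed.

(** * Strict convexity of the [p]-th power of the Euclidean norm *)

Section euclidean_norm.
Context {R : realType} {n : nat}.
Implicit Types a b x : 'rV[R]_n.

Lemma sqr_enorm x : enorm x ^+ 2 = \sum_(i < n) x 0 i ^+ 2.
Proof. by rewrite sqr_sqrtr// sumr_ge0// => i _; exact: sqr_ge0. Qed.

Lemma enorm_ge0 x : 0 <= enorm x. Proof. exact: sqrtr_ge0. Qed.

Lemma enorm0 : enorm (0 : 'rV[R]_n) = 0.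
Proof. by rewrite /enorm big1 ?sqrtr0// => i _; rewrite mxE expr0n. Qed.

Lemma enorm_eq0 x : enorm x = 0 -> x = 0.
Proof.
move=> x0; have /esym/eqP := sqr_enorm x.
rewrite x0 expr0n/= psumr_eq0 => [|i _]; last exact: sqr_ge0.
move=> /allP h; apply/rowP => i; rewrite mxE; apply/eqP.
by have := h i (mem_index_enum i); rewrite /= sqrf_eq0.
Qed.

Lemma enorm_gt0 x : x <> 0 -> 0 < enorm x.
Proof.
by rewrite lt_neqAle enorm_ge0 andbT eq_sym => x0; apply/eqP=> /enorm_eq0.
Qed.

(** For nonzero vectors, expand the sum of the squares of [|b| a_i - |a| b_i], which is nonnegative,
    and cancel the positive factor [|a| |b|]. *)
Lemma enorm_cauchy_schwarz a b :
  \sum_(i < n) a 0 i * b 0 i <= enorm a * enorm b.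
Proof.
have [->|a0] := pselect (a = 0).
  by rewrite enorm0 mul0r big1// => i _; rewrite mxE mul0r.
have [->|b0] := pselect (b = 0).
  by rewrite enorm0 mulr0 big1// => i _; rewrite mxE mulr0.
have A := enorm_gt0 _ a0; have B := enorm_gt0 _ b0.
have : 0 <= \sum_(i < n) (enorm b * a 0 i - enorm a * b 0 i) ^+ 2.
  by rewrite sumr_ge0// => i _; exact: sqr_ge0.
have -> : \sum_(i < n) (enorm b * a 0 i - enorm a * b 0 i) ^+ 2 =
    enorm b ^+ 2 * enorm a ^+ 2 + enorm a ^+ 2 * enorm b ^+ 2
    - 2 * enorm a * enorm b * \sum_(i < n) a 0 i * b 0 i.
  rewrite [in X in _ * X + _]sqr_enorm [in X in _ + _ * X - _]sqr_enorm.
  rewrite !mulr_sumr -big_split -sumrB/=.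
  by apply: eq_bigr => i _; ring.
have AB : 0 < enorm a * enorm b by exact: mulr_gt0.
set S := \sum_(i < n) _; rewrite -[S <= _](ler_pM2l AB).
by move: (enorm a) (enorm b) S => x y s; nra.
Qed.

Lemma sqr_enorm_midpoint a b :
  enorm (2^-1 *: (a + b)) ^+ 2 =
  4^-1 * (enorm a ^+ 2 + enorm b ^+ 2 + 2 * \sum_(i < n) a 0 i * b 0 i).
Proof.
rewrite !sqr_enorm !mulr_sumr -!big_split mulr_sumr/=.
by apply: eq_bigr => i _; rewrite !mxE; field.
Qed.

Lemma enorm_midpoint_le a b :
  enorm (2^-1 *: (a + b)) <= 2^-1 * (enorm a + enorm b).
Proof.
rewrite -(@ler_pXn2r _ 2)// ?nnegrE ?enorm_ge0//; last first.
  by rewrite mulr_ge0// addr_ge0// enorm_ge0.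
rewrite sqr_enorm_midpoint; have := enorm_cauchy_schwarz a b.
by move: (enorm a) (enorm b) => x y; nra.
Qed.

(** By the parallelogram identity, the squared norm of the midpoint is [|a|^2 - |a - b|^2 / 4] when
    the two norms agree. *)
Lemma enorm_midpoint_lt a b : a <> b -> enorm a = enorm b ->
  enorm (2^-1 *: (a + b)) < enorm a.
Proof.
move=> ab eab; rewrite -(@ltr_pXn2r _ 2)// ?nnegrE ?enorm_ge0//.
have : 0 < enorm (a - b) ^+ 2.
  by rewrite exprn_gt0// enorm_gt0// => /subr0_eq.
have -> : enorm (a - b) ^+ 2 = enorm a ^+ 2 + enorm b ^+ 2 -
    2 * \sum_(i < n) a 0 i * b 0 i.
  rewrite !sqr_enorm mulr_sumr -!big_split -sumrB/=.
  by apply: eq_bigr => i _; rewrite !mxE; ring.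
by rewrite sqr_enorm_midpoint -eab; lra.
Qed.

(** Strictness has two sources: the roundness of the Euclidean ball if the norms agree, and the
    strict convexity of the scalar power if they differ. *)
Lemma enorm_powR_midpoint_lt (p : R) a b : 1 < p -> a <> b ->
  enorm (2^-1 *: (a + b)) `^ p < 2^-1 * (enorm a `^ p + enorm b `^ p).
Proof.
move=> p1 ab; have p0 : 0 < p by lra.
have [eab|eab] := eqVneq (enorm a) (enorm b).
  have := enorm_midpoint_lt _ _ ab eab.
  move/(gt0_ltr_powR p0 (enorm_ge0 _) (enorm_ge0 _)); rewrite -eab.
  by lra.
apply: le_lt_trans (powR_midpoint_lt p _ _ p1 (enorm_ge0 _) (enorm_ge0 _) eab).
apply: (ge0_ler_powR (ltW p0)); rewrite ?nnegrE ?enorm_ge0//.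
  by rewrite mulr_ge0// addr_ge0// enorm_ge0.
exact: enorm_midpoint_le.
Qed.

Lemma enorm_powR_midpoint_le (p : R) a b : 1 < p ->
  enorm (2^-1 *: (a + b)) `^ p <= 2^-1 * (enorm a `^ p + enorm b `^ p).
Proof.
move=> p1; have [<-|ab] := pselect (a = b).
  rewrite (_ : 2^-1 *: (a + a) = a); first by lra.
  by apply/rowP => i; rewrite !mxE; field.
exact/ltW/enorm_powR_midpoint_lt.
Qed.

End euclidean_norm.

(** * Borel sets of R^n and integrability against test functions *)

Section measurability_rV.
Context {R : realType} {n : nat}.
Local Notation mu := (@lebesgue_rV R n).

(** The sigma-algebra is generated by the coordinates, so its link with the topology has to be
    proved: an open set is the union of the countably many boxes with rational corners that it
    contains. Balls of the sup norm are cubes, so a small enough box around [x] fits inside. *)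
Lemma open_measurable_rV (U : set 'rV[R]_n) : open U -> measurable U.
Proof.
move=> oU.
pose box (z : 'rV[rat]_n * 'rV[rat]_n) : set 'rV[R]_n :=
  [set x | forall i, [set` `]ratr (z.1 0 i), ratr (z.2 0 i)[%R] (x 0 i : R)].
have -> : U = \bigcup_z [set x | box z x /\ box z `<=` U].
  apply/seteqP; split=> [x Ux|x [z _ [zx]]]; last exact.
  have := open_nbhs_nbhs (conj oU Ux) => /nbhs_ballP[e /= e0 eU].
  have xl i : {q : rat | (ratr q : R) \in `]x 0 i - e, x 0 i[}.
    by apply/cid/rat_in_itvoo; rewrite ltrBlDr ltrDl.
  have xr i : {q : rat | (ratr q : R) \in `]x 0 i, x 0 i + e[}.
    by apply/cid/rat_in_itvoo; rewrite ltrDl.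
  exists (\row_i projT1 (xl i), \row_i projT1 (xr i)) => //; split=> /=.
    move=> i /=; rewrite !mxE.
    case: (xl i) (xr i) => /= q + [/= r +].
    by rewrite !in_itv/= => /andP[_ ->] /andP[->].
  move=> y /= yz; apply: eU; split=> // i j; rewrite ord1 /ball/=.
  have := yz j; rewrite /= !mxE.
  case: (xl j) (xr j) => /= q + [/= r +].
  rewrite !in_itv/= => /andP[h1 h2] /andP[h3 h4] /andP[h5 h6].
  by rewrite ltr_norml; apply/andP; split; lra.
apply: countable_bigcupT_measurable => // z.
(* A box that is not contained in [U] contributes the empty set, so the union can range over all
   pairs of rational corners. *)
have [zU|zU] := pselect (box z `<=` U); last first.
  by rewrite (_ : mkset _ = set0) //; apply/seteqP; split=> // x [].
rewrite (_ : mkset _ = box z); last by apply/seteqP; split=> // x [].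
apply: (@measurable_box R n
  (fun i => [set` `]ratr (z.1 0 i), ratr (z.2 0 i)[%R])) => i.
exact: measurable_itv.
Qed.

Lemma closed_measurable_rV (K : set 'rV[R]_n) : closed K -> measurable K.
Proof.
move=> /closed_openC/open_measurable_rV/measurableC; by rewrite setCK.
Qed.

Lemma compact_measurable_rV (K : set 'rV[R]_n) : compact K -> measurable K.
Proof.
move=> /(compact_closed (@norm_hausdorff _ _)).
exact: closed_measurable_rV.
Qed.

Lemma continuous_measurable_rV (f : 'rV[R]_n -> R) :
  continuous f -> measurable_fun setT f.
Proof.
move=> /continuousP cf; apply: (measurability _ (RGenOpens.measurableE R)).
move=> _ [_ [a [b ->] <-]]; rewrite setTI.
apply: open_measurable_rV; apply: cf; exact: interval_open.
Qed.

Lemma loc_integrable_lin (a b : R) (u v : 'rV[R]_n -> R) :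
  loc_integrable u -> loc_integrable v ->
  loc_integrable (fun x => a * u x + b * v x).
Proof.
move=> [mu' iu] [mv iv]; split.
  by apply: measurable_funD; apply: measurable_funM => //.
move=> K cK; have mK := compact_measurable_rV _ cK.
have := integrableD mK (integrableZl mK a (iu K cK))
                       (integrableZl mK b (iv K cK)).
by apply: eq_integrable => // x _ /=; rewrite EFinD !EFinM.
Qed.

(** [f] is bounded on [K], so the product is integrable there, and it vanishes elsewhere. This makes
    both integrands in the definition of a weak derivative integrable. *)
Lemma integrable_mul_compact (u f : 'rV[R]_n -> R) (K : set 'rV[R]_n) :
  loc_integrable u -> continuous f -> compact K ->
  (forall x, ~ K x -> f x = 0) ->
  mu.-integrable setT (fun x => (u x * f x)%:E).
Proof.
move=> [_ iu] cf cK f0; have mK := compact_measurable_rV _ cK.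
have bf : [bounded f x | x in K].
  have : bounded_set (f @` K).
    apply/compact_bounded/continuous_compact => //.
    exact: continuous_subspaceT.
  move=> [M [Mr MP]]; exists M; split=> // x Mx y Ky.
  by apply: (MP x Mx); exists y.
have mf := measurable_funTS (D := K) (continuous_measurable_rV _ cf).
have := integrableMr mK mf bf (iu K cK).
move/(integrable_mkcond _ mK); apply: eq_integrable => // x _ /=.
rewrite patchE; case: ifPn => [_|/negP]; first by rewrite /= -EFinM mulrC.
by rewrite in_setE => /f0 ->; rewrite mulr0.
Qed.

Lemma test_function_continuous (phi : 'rV[R]_n -> R) :
  test_function phi -> continuous phi.
Proof. by move=> [/(_ 0%N)]. Qed.

Lemma test_function_derive_continuous (phi : 'rV[R]_n -> R) i :
  test_function phi -> continuous (fun x => 'D_(delta_mx 0 i) phi x).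
Proof. by move=> [/(_ 1%N)/= [_ /(_ i)[]]]. Qed.

Lemma test_function_eq0 (phi : 'rV[R]_n -> R) x :
  ~ closure [set x | phi x != 0] x -> phi x = 0.
Proof.
by move=> Nx; apply/eqP/negPn/negP => phix; apply: Nx; exact: subset_closure.
Qed.

(** The complement of the closed support is open, so near [x] the function coincides with the
    constant 0. *)
Lemma test_function_derive_eq0 (phi : 'rV[R]_n -> R) (v : 'rV[R]_n) x :
  ~ closure [set x | phi x != 0] x -> 'D_v phi x = 0.
Proof.
move=> Nx.
have : \forall y \near x, phi y = 0.
  have oC : open (~` closure [set x | phi x != 0]).
    exact/closed_openC/closed_closure.
  have := open_nbhs_nbhs (conj oC Nx); apply: filterS => y.
  exact: test_function_eq0.
move=> /(@near_eq_derive R 'rV[R]_n R phi (cst 0) x v) ->.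
exact: derive_cst.
Qed.

End measurability_rV.

(** * Linearity of weak gradients, and the equality case for gradient norms *)

Section morrey_space.
Context {R : realType} {n : nat}.
Local Notation mu := (@lebesgue_rV R n).
Implicit Types (u v phi : 'rV[R]_n -> R) (g : 'rV[R]_n -> 'rV[R]_n) (p : R).

Lemma integral_lin (a b : R) u v :
  mu.-integrable setT (EFin \o u) -> mu.-integrable setT (EFin \o v) ->
  (\int[mu]_x (a * u x + b * v x)%:E =
   a%:E * \int[mu]_x (u x)%:E + b%:E * \int[mu]_x (v x)%:E)%E.
Proof.
move=> iu iv; under eq_integral do rewrite EFinD !EFinM.
by rewrite integralD ?integralZl//; exact: integrableZl.
Qed.

Lemma weak_partial_lin (i : 'I_n) (a b : R) u1 u2 v1 v2 :
  weak_partial i u1 v1 -> weak_partial i u2 v2 ->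
  weak_partial i (fun x => a * u1 x + b * u2 x) (fun x => a * v1 x + b * v2 x).
Proof.
move=> [lu1 lv1 h1] [lu2 lv2 h2]; split; [exact: loc_integrable_lin..|].
move=> phi tphi; have [_ cK] := tphi.
have iD u : loc_integrable u ->
    mu.-integrable setT (fun x => (u x * 'D_(delta_mx 0 i) phi x)%:E).
  move=> lu; apply: integrable_mul_compact lu _ cK _.
    exact: test_function_derive_continuous.
  by move=> x; exact: test_function_derive_eq0.
have iM v : loc_integrable v -> mu.-integrable setT (fun x => (v x * phi x)%:E).
  move=> lv; apply: integrable_mul_compact lv _ cK _.
    exact: test_function_continuous.
  by move=> x; exact: test_function_eq0.
under eq_integral do rewrite mulrDl -!mulrA.
rewrite integral_lin; [|exact: iD..].
under [in RHS]eq_integral do rewrite mulrDl -!mulrA.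
rewrite integral_lin; [|exact: iM..].
(* In [\bar R] the opposite distributes over a sum that avoids [+oo - oo]; here the integrals are
   finite. *)
rewrite h1// h2// !muleN oppeD//.
by rewrite fin_num_adde_defl// fin_numM//; apply: integrable_fin_num (iM _ _).
Qed.

Lemma weak_gradient_lin (a b : R) u1 u2 g1 g2 :
  weak_gradient u1 g1 -> weak_gradient u2 g2 ->
  weak_gradient (fun x => a * u1 x + b * u2 x)
                (fun x => a *: g1 x + b *: g2 x).
Proof.
move=> h1 h2 i; under [X in weak_partial _ _ X]eq_fun do rewrite !mxE.
exact: weak_partial_lin.
Qed.

Lemma D1p_lin p (a b : R) u1 u2 : 1 <= p -> D1p p u1 -> D1p p u2 ->
  D1p p (fun x => a * u1 x + b * u2 x).
Proof.
move=> p1 [c1 l1 [g1 wg1 L1]] [c2 l2 [g2 wg2 L2]]; split.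
- have cM (k : R) u : continuous u -> continuous (fun x => k * u x).
    by move=> cu x; apply: (cvgM (cvg_cst k) (cu x)).
  by move=> x; apply: (@cvgD R R^o _ _ _ _ _ _ _ (cM a u1 c1 x) (cM b u2 c2 x)).
- exact: loc_integrable_lin.
- exists (fun x => a *: g1 x + b *: g2 x); first exact: weak_gradient_lin.
  have [L0 Llin] : submod_closed (Lfun mu p%:E).
    by apply: Lfun_submod_closed; rewrite lee_fin.
  move=> i; under eq_fun do rewrite !mxE.
  (* Closure has the form [a *: f + h], so it is used twice, starting from [h = 0]. *)
  have := Llin a _ _ (L1 i) (Llin b _ _ (L2 i) L0).
  by rewrite addr0.
Qed.

Lemma measurable_enorm g :
  (forall i, measurable_fun setT (fun x => g x 0 i)) ->
  measurable_fun setT (fun x => enorm (g x)).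
Proof.
move=> mg; have msqrt : measurable_fun setT (@Num.sqrt R).
  by apply: continuous_measurable_fun; exact: sqrt_continuous.
apply: (measurableT_comp msqrt).
by apply: measurable_sum => i; exact: measurable_funX.
Qed.

Lemma weak_gradient_measurable u g i :
  weak_gradient u g -> measurable_fun setT (fun x => g x 0 i).
Proof. by move=> /(_ i)[_ []]. Qed.

Lemma poweR_grad_norm p g : p != 0 ->
  (grad_norm p g `^ p = \int[mu]_x (enorm (g x) `^ p)%:E)%E.
Proof.
move=> p0; rewrite /grad_norm poweR_Lnorm//; apply: eq_integral => x _ /=.
by rewrite ger0_norm ?enorm_ge0.
Qed.

(* The nonnegative defect of midpoint convexity of |.|^p has zero integral, and
   strict convexity turns its pointwise vanishing into g1 = g2. *)
Lemma grad_norm_midpoint_eq p g1 g2 (N : R) : 1 < p ->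
  (forall i, measurable_fun setT (fun x => g1 x 0 i)) ->
  (forall i, measurable_fun setT (fun x => g2 x 0 i)) ->
  grad_norm p g1 = N%:E -> grad_norm p g2 = N%:E ->
  (N%:E <= grad_norm p (fun x => 2^-1 *: g1 x + 2^-1 *: g2 x)%R)%E ->
  grad_norm p (fun x => 1 *: g1 x + (- 1) *: g2 x)%R = 0%E.
Proof.
move=> p1 mg1 mg2 N1 N2 Nm.
have p0 : p != 0 by rewrite gt_eqF//; lra.
have N0 : 0 <= N by rewrite -lee_fin -N1 Lnorm_ge0.
have mlin a b i : measurable_fun setT (fun x => (a *: g1 x + b *: g2 x) 0 i).
  under eq_fun do rewrite !mxE.
  by apply: measurable_funD; exact: measurable_funM.
have mpow g : (forall i, measurable_fun setT (fun x => g x 0 i)) ->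
    measurable_fun setT (fun x => enorm (g x) `^ p).
  move=> mg; apply: (measurableT_comp (measurable_powR p)).
  exact: measurable_enorm.
pose F1 x := enorm (g1 x) `^ p; pose F2 x := enorm (g2 x) `^ p.
pose Fm x := enorm (2^-1 *: g1 x + 2^-1 *: g2 x) `^ p.
have mF1 : measurable_fun setT F1 by exact: mpow.
have mF2 : measurable_fun setT F2 by exact: mpow.
have mFm : measurable_fun setT Fm by apply: mpow => i; exact: mlin.
have iF (F : 'rV[R]_n -> R) : measurable_fun setT F -> (forall x, 0 <= F x) ->
    (\int[mu]_x (F x)%:E = (N `^ p)%:E)%E -> mu.-integrable setT (EFin \o F).
  move=> mF F0 iF; apply/integrableP; split; first exact/measurable_EFinP.
  under eq_integral => x _ do rewrite /= ger0_norm//.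
  by rewrite iF ltry.
have I1 : (\int[mu]_x (F1 x)%:E = (N `^ p)%:E)%E.
  by rewrite -poweR_grad_norm// N1 poweR_EFin.
have I2 : (\int[mu]_x (F2 x)%:E = (N `^ p)%:E)%E.
  by rewrite -poweR_grad_norm// N2 poweR_EFin.
have i1 : mu.-integrable setT (EFin \o F1).
  by apply: (iF F1 mF1 _ I1) => x; exact: powR_ge0.
have i2 : mu.-integrable setT (EFin \o F2).
  by apply: (iF F2 mF2 _ I2) => x; exact: powR_ge0.
have I12 : (\int[mu]_x (2^-1 * F1 x + 2^-1 * F2 x)%:E = (N `^ p)%:E)%E.
  by rewrite integral_lin// I1 I2 -!EFinM -EFinD; congr EFin; field.
have m12 : measurable_fun setT (fun x => 2^-1 * F1 x + 2^-1 * F2 x).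
  by apply: measurable_funD; exact: measurable_funM.
have Fm_le x : Fm x <= 2^-1 * F1 x + 2^-1 * F2 x.
  by rewrite /Fm -scalerDr -mulrDr; exact: enorm_powR_midpoint_le.
(* Convexity bounds this integral above by [N ^ p], and the assumed lower bound on the norm of the
   average gives the converse. *)
have Im : (\int[mu]_x (Fm x)%:E = (N `^ p)%:E)%E.
  apply/eqP; rewrite eq_le; apply/andP; split.
    rewrite -I12; apply: ge0_le_integral => //.
    - by move=> x _; rewrite lee_fin powR_ge0.
    - exact/measurable_EFinP.
    - exact/measurable_EFinP.
    - by move=> x _; rewrite lee_fin.
  rewrite -poweR_grad_norm// -poweR_EFin.
  apply: gt0_ler_poweR => //; first by lra.
    by rewrite in_itv/= leey andbT lee_fin.
  by rewrite in_itv/= leey andbT Lnorm_ge0.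
have im : mu.-integrable setT (EFin \o Fm).
  by apply: (iF Fm mFm _ Im) => x; exact: powR_ge0.
have i12 : mu.-integrable setT (EFin \o (fun x => 2^-1 * F1 x + 2^-1 * F2 x)).
  by apply: (iF _ m12 _ I12) => x; exact: le_trans (powR_ge0 _ _) (Fm_le x).
(* The convexity defect, written as a linear combination so that [integral_lin] applies. *)
pose G x := 1 * (2^-1 * F1 x + 2^-1 * F2 x) + (- 1) * Fm x.
have G0 : (\int[mu]_x `|(G x)%:E| = 0)%E.
  under eq_integral => x _.
    rewrite abse_EFin ger0_norm; last first.
      by rewrite /G; have := Fm_le x; lra.
    over.
  rewrite integral_lin// I12 Im -!EFinM -EFinD; congr EFin; ring.
have mG : measurable_fun setT (EFin \o G).
  apply/measurable_EFinP; apply: measurable_funD; exact: measurable_funM.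
have aeG : ae_eq mu setT (EFin \o G) (cst 0%E).
  by apply/(ae_eq_integral_abs mu _ mG).
have ae0 : ae_eq mu setT
    (fun x => (enorm (1 *: g1 x + (- 1) *: g2 x) `^ p)%:E) (cst 0%E).
  move: aeG; apply: filterS => x /= Gx _.
  have {}Gx : G x = 0 by apply: EFin_inj; exact: Gx.
  have [->|g12] := pselect (g1 x = g2 x).
    by rewrite -scalerDl subrr scale0r enorm0 powR0.
  exfalso; have := enorm_powR_midpoint_lt _ _ _ p1 g12.
  rewrite scalerDr -/(F1 x) -/(F2 x) -/(Fm x).
  by move: Gx; rewrite /G; lra.
have : (grad_norm p (fun x => 1 *: g1 x + (- 1) *: g2 x)%R `^ p = 0)%E.
  rewrite poweR_grad_norm//.
  rewrite (@ae_eq_integral _ _ _ _ setT (cst 0%E) _ measurableT _ _ ae0).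
  - by rewrite integral0.
  - by apply/measurable_EFinP; apply: mpow => i; exact: mlin.
  - exact: measurable_cst.
by move=> /poweR_eq0_eq0; apply; exact: Lnorm_ge0.
Qed.

Lemma holder_seminorm_ge p u x y : x <> y ->
  ((holder_quotient p u x y)%:E <= holder_seminorm p u)%E.
Proof. by move=> xy; apply: ereal_sup_ubound; exists (x, y). Qed.

(** The denominator of each quotient is positive, so every numerator must vanish. This serves both
    to make the seminorm of a nonconstant function positive and to conclude that [u1 - u2] is
    constant. *)
Lemma holder_seminorm_le0 p u : (holder_seminorm p u <= 0)%E ->
  forall x y, u x = u y.
Proof.
move=> u0 x y; have [->//|xy] := pselect (x = y).
have := le_trans (holder_seminorm_ge p u _ _ xy) u0.
rewrite lee_fin /holder_quotient pmulr_lle0.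
  by rewrite normr_le0 subr_eq0 => /eqP.
by rewrite invr_gt0 powR_gt0// enorm_gt0// => /subr0_eq.
Qed.

End morrey_space.

(* In \bar R a product with an infinite factor is 0 or infinite. *)
Lemma mule_fin_gt0_factors {R : realType} (s : R) (c G : \bar R) :
  0 < s -> (0 <= G)%E -> s%:E = (c * G)%E ->
  exists C N : R, [/\ c = C%:E, G = N%:E, 0 < C & s = C * N].
Proof.
move=> s0; have s0E : (0 < s%:E)%E by rewrite lte_fin.
case: G => [N||//] G0.
- case: c => [C||].
  + move=> [sCN]; exists C, N; split=> //.
    by move: G0; rewrite lee_fin => G0; nra.
  + move=> h; move: G0; rewrite le_eqVlt => /predU1P[N0|N0].
      by move: s0E; rewrite h -N0 mule0 ltxx.
    by move: h; rewrite gt0_mulye.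
  + move=> h; move: G0; rewrite le_eqVlt => /predU1P[N0|N0].
      by move: s0E; rewrite h -N0 mule0 ltxx.
    by move: h; rewrite gt0_mulNye.
- move=> h; have [c0|c0|c0] := ltgtP 0%E c.
  + by move: h; rewrite gt0_muley.
  + by move: h; rewrite lt0_muley.
  + by move: s0E; rewrite h -c0 mul0e ltxx.
Qed.

Theorem corollary3p2 (R : realType) (n : nat) (p : R)
    (u1 u2 : 'rV[R]_n -> R) (x0 y0 : 'rV[R]_n) :
  (1 <= n)%N -> n%:R < p ->
  extremal p u1 -> extremal p u2 ->
  ~ (exists c, forall x, u1 x = c) -> ~ (exists c, forall x, u2 x = c) ->
  x0 <> y0 ->
  holder_seminorm p u1 = (holder_quotient p u1 x0 y0)%:E ->
  holder_seminorm p u2 = (holder_quotient p u2 x0 y0)%:E ->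
  u1 x0 = u2 x0 -> u1 y0 = u2 y0 ->
  forall x, u1 x = u2 x.
Proof.
move=> n1 np [D1 [g1 wg1 e1]] [D2 [g2 wg2 e2]] nc1 _ xy0 s1 s2 ex ey.
have p1 : 1 < p by apply: le_lt_trans np; rewrite ler1n.
set S := holder_quotient p u1 x0 y0 in s1.
have S2 : holder_quotient p u2 x0 y0 = S.
  by rewrite /S /holder_quotient ex ey.
have S0 : 0 < S.
  rewrite lt_neqAle eq_sym divr_ge0 ?powR_ge0// andbT; apply/eqP => S0.
  apply: nc1; exists (u1 x0) => x; apply: (holder_seminorm_le0 p).
  by rewrite s1 S0.
(* As [S] is finite and positive, so are the Morrey constant [C] and the gradient norm [N]. *)
have [C [N [cC GN C0 SCN]]] := mule_fin_gt0_factors _ _ _ S0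
  (Lnorm_ge0 _ _ _) (etrans (esym s1) e1).
have [C' [N' [cC' GN' _ SCN']]] := mule_fin_gt0_factors _ _ _ S0
  (Lnorm_ge0 _ _ _) (etrans (esym (etrans s2 (congr1 EFin S2))) e2).
(* Both extremals have seminorm [S], so the common factor [C] cancels. *)
have EN : N' = N.
  move: cC' SCN'; rewrite cC => -[<-]; rewrite SCN => /(mulfI _) ->//.
  by rewrite gt_eqF.
rewrite {C' cC' SCN'}EN in GN'.
(* Without an admissible constant the infimum would be [+oo], against [cC]. *)
have [K0 mK0] : exists K, morrey_bound n p K.
  apply/not_existsP => hN; move: cC; rewrite /morrey_const.
  by rewrite (_ : mkset _ = set0) ?image_set0 ?ereal_inf0// -subset0 => K /hN.
pose w (a b : R) x := a * u1 x + b * u2 x.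
have Dw a b : D1p p (w a b) by apply: D1p_lin => //; exact: ltW.
have gw a b := weak_gradient_lin a b _ _ _ _ wg1 wg2.
(* Suppose that the average has gradient norm [G < N]. Its quotient at [x0], [y0] is still [S], so
   [S <= K * G] for every admissible [K]. Hence [G] is positive and [S / G] is a lower bound of the
   admissible constants, so that [C * N = S <= C * G], a contradiction. *)
have Nm : (N%:E <= grad_norm p (fun x => 2^-1 *: g1 x + 2^-1 *: g2 x)%R)%E.
  rewrite leNgt; apply/negP.
  set G := grad_norm _ _ => GN_lt.
  have G0 : (0 <= G)%E by exact: Lnorm_ge0.
  have GE : G = (fine G)%:E.
    by rewrite fineK// ge0_fin_numE// (lt_trans GN_lt)// ltry.
  have Sw : holder_quotient p (w 2^-1 2^-1) x0 y0 = S.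
    rewrite /S /holder_quotient /w ex ey; congr (`|_| / _); lra.
  have bound K : morrey_bound n p K -> S <= K * fine G.
    move=> mK.
    have := le_trans (holder_seminorm_ge p _ _ _ xy0)
                     (mK _ _ (Dw 2^-1 2^-1) (gw 2^-1 2^-1)).
    by rewrite Sw -/G GE -EFinM lee_fin.
  have Gr0 : 0 < fine G.
    rewrite lt_neqAle fine_ge0// andbT eq_sym; apply/eqP => h.
    by have := bound _ mK0; rewrite h mulr0; lra.
  have : ((S / fine G)%:E <= C%:E)%E.
    rewrite -cC; apply/ereal_infP => _ [K mK <-].
    by rewrite lee_fin ler_pdivrMr//; exact: bound.
  rewrite lee_fin ler_pdivrMr// SCN ler_pM2l//.
  by move: GN_lt; rewrite GE lte_fin; lra.
have Z := grad_norm_midpoint_eq p _ _ _ p1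
  (fun i => weak_gradient_measurable _ _ i wg1)
  (fun i => weak_gradient_measurable _ _ i wg2) GN GN' Nm.
(* The gradient norm of [u1 - u2] is 0, so the bound with [K0] reads [K0 * 0 = 0], whatever the
   value of [K0]. *)
have := mK0 _ _ (Dw 1 (-1)) (gw 1 (-1)); rewrite Z mule0 => w0 x.
by have := holder_seminorm_le0 _ _ w0 x x0; rewrite /w ex; lra.
Qed.
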